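(* (Two-sided $\Sigma$-criterion.) Let $P=K[X]$, $\sigma:P\to P$ and $S=P[s;\sigma]$ with a monomial ordering be as in the context. Let $G$ be an $s$-homogeneous basis of a graded two-sided ideal $J\subset S$. Then $G$ is a Gröbner basis of $J$ if and only if for all $f,g\in G\setminus\{0\}$ and for any $i,j\ge0$, the S-polynomials $\mathrm{spoly}(f,s^igs^j)$ (when $\deg_s(f)=\deg_s(g)+i+j$) and $\mathrm{spoly}(fs^i,s^jg)$ (when $\deg_s(f)+i=\deg_s(g)+j$) have a Gröbner representation with respect to $\Sigma\,G\,\Sigma$.
   Context: $K$ is a field, $X=\{x_0,x_1,\ldots\}$ a countable set of variables, $P=K[X]$ the commutative polynomial ring, $\mathrm{Mon}(P)$ its set of monomials (including 1). $\sigma:P\to P$ is an injective $K$-algebra endomorphism of infinite order mapping monomials to monomials, with $\gcd(\sigma(x_i),\sigma(x_j))=1$ for $i\neq j$. $S=P[s;\sigma]$ is the free left $P$-module with basis $\Sigma=\{s^i\}_{i\ge0}$ and multiplication determined by $sf=\sigma(f)s$ ($f\in P$); it is graded by $S_i=Ps^i$, whose elements are called $s$-homogeneous, with $\deg_s(f)=i$ for $0\ne f\in S_i$. $\mathrm{Mon}(S)=\{ms^i\mid m\in\mathrm{Mon}(P),i\ge0\}$. $S$ is endowed with a monomial ordering $\prec$: a total well-ordering of $\mathrm{Mon}(S)$ with $v\prec w\Rightarrow pvq\prec pwq$ for all $v,w,p,q\in\mathrm{Mon}(S)$. For $f\neq0$, $\mathrm{lm}(f)$ is the largest monomial occurring in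 $f$ and $\mathrm{lc}(f)$ its coefficient; $\mathrm{lm}(G)=\{\mathrm{lm}(f)\mid f\in G,f\ne0\}$. ''Basis'' of a two-sided ideal means generating set. $G\subset J$ is a Gröbner basis of the two-sided ideal $J$ if $\mathrm{lm}(G)$ and $\mathrm{lm}(J)$ generate the same two-sided ideal of $S$. $\Sigma G\Sigma=\{s^igs^j\mid g\in G,i,j\ge0\}$. If $\mathrm{lm}(f)=ms^i$, $\mathrm{lm}(g)=ns^i$ with $m,n\in\mathrm{Mon}(P)$ and $l=\mathrm{lcm}(m,n)$, then $\mathrm{spoly}(f,g)=\frac{l}{\mathrm{lc}(f)m}f-\frac{l}{\mathrm{lc}(g)n}g$. An element $h\in S$ has a Gröbner representation with respect to $G'\subset S$ (in the $P$-module sense) if $h=\sum_kf_kg_k$ is a finite sum with $f_k\in P\setminus\{0\}$, $g_k\in G'\setminus\{0\}$ and $\mathrm{lm}(h)\succeq\mathrm{lm}(f_k)\mathrm{lm}(g_k)$ for all $k$ (the zero element has the empty representation). *)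

(* Defs.v *)
From HB Require Import structures.
From mathcomp Require Import all_boot all_order all_algebra finmap.
From mathcomp.multinomials Require Import monalg.

Set Implicit Arguments.
Unset Strict Implicit.
Unset Printing Implicit Defensive.

Import GRing.Theory.
Local Open Scope ring_scope.

Section SkewPolynomialRing.
Context {R : nzRingType}.

(* R[s; sigma]: SkewPoly p stands for \sum_i p`_i s^i, with coefficients on the
   left. Addition and the left R-action are those of {poly R}; the product is
   not, whence a wrapper type rather than an alias of {poly R}. *)
Record skewpoly (sigma : {rmorphism R -> R}) : Type :=
  SkewPoly { skewcoefs : {poly R} }.

Variable sigma : {rmorphism R -> R}.
Local Notation S := (skewpoly sigma).
Local Notation Skew := (@SkewPoly sigma).

HB.instance Definition _ := [isNew for @skewcoefs sigma].
HB.instance Definition _ := [Choice of S by <:].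

Definition skew_zero : S := Skew 0.
Definition skew_opp (f : S) : S := Skew (- skewcoefs f).
Definition skew_add (f g : S) : S := Skew (skewcoefs f + skewcoefs g).
Definition skew_scale (a : R) (f : S) : S := Skew (a *: skewcoefs f).

Fact skew_addA : associative skew_add.
Proof. by move=> f g h; congr SkewPoly; rewrite /= addrA. Qed.
Fact skew_addC : commutative skew_add.
Proof. by move=> f g; congr SkewPoly; rewrite addrC. Qed.
Fact skew_add0 : left_id skew_zero skew_add.
Proof. by move=> f; apply: val_inj; rewrite /= add0r. Qed.
Fact skew_addN : left_inverse skew_zero skew_opp skew_add.
Proof. by move=> f; apply: val_inj; rewrite /= addNr. Qed.

HB.instance Definition _ := GRing.isZmodule.Build S
  skew_addA skew_addC skew_add0 skew_addN.

Fact skew_scaleA a b (f : S) :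
  skew_scale a (skew_scale b f) = skew_scale (a * b) f.
Proof. by apply: val_inj; rewrite /= scalerA. Qed.
Fact skew_scale1 : left_id 1 skew_scale.
Proof. by move=> f; apply: val_inj; rewrite /= scale1r. Qed.
Fact skew_scaleDr : right_distributive skew_scale +%R.
Proof. by move=> a f g; apply: val_inj; rewrite /= scalerDr. Qed.
Fact skew_scaleDl (f : S) : {morph skew_scale^~ f : a b / a + b}.
Proof. by move=> a b; apply: val_inj; rewrite /= scalerDl. Qed.

HB.instance Definition _ := GRing.Zmodule_isLmodule.Build R S
  skew_scaleA skew_scale1 skew_scaleDr skew_scaleDl.

Definition scoef (f : S) (i : nat) : R := (skewcoefs f)`_i.

(* deg_s f, for f != 0 (junk value 0 at f = 0) *)
Definition sdeg (f : S) : nat := (size (skewcoefs f)).-1.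

(* (a s^i)(b s^j) = a sigma^i(b) s^(i + j) *)
Definition skew_mul (f g : S) : S := Skew
  (\poly_(k < (size (skewcoefs f) + size (skewcoefs g)).-1)
     \sum_(i < k.+1) scoef f i * iter i sigma (scoef g (k - i))).

Definition skew_one : S := Skew 1.

Definition skewX : S := Skew 'X.

Lemma scoefP (f g : S) : (forall i, scoef f i = scoef g i) -> f = g.
Proof. by move=> fg; apply/val_inj/polyP. Qed.

Lemma scoefD (f g : S) i : scoef (f + g) i = scoef f i + scoef g i.
Proof. exact: coefD. Qed.

Lemma scoefZ (a : R) (f : S) i : scoef (a *: f) i = a * scoef f i.
Proof. exact: coefZ. Qed.

Lemma iter_sigma0 i : iter i sigma 0 = 0.
Proof. by elim: i => //= i ->; rewrite rmorph0. Qed.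

Lemma iter_sigma1 i : iter i sigma 1 = 1.
Proof. by elim: i => //= i ->; rewrite rmorph1. Qed.

Lemma iter_sigmaD i : {morph iter i sigma : x y / x + y}.
Proof. by move=> x y; elim: i => //= i ->; rewrite rmorphD. Qed.

Lemma iter_sigmaM i : {morph iter i sigma : x y / x * y}.
Proof. by move=> x y; elim: i => //= i ->; rewrite rmorphM. Qed.

Lemma iter_sigma_sum i I r (P : pred I) (F : I -> R) :
  iter i sigma (\sum_(j <- r | P j) F j) = \sum_(j <- r | P j) iter i sigma (F j).
Proof. exact: (big_morph _ (iter_sigmaD i) (iter_sigma0 i)). Qed.

Lemma scoef_mul (f g : S) k :
  scoef (skew_mul f g) k
    = \sum_(i < k.+1) scoef f i * iter i sigma (scoef g (k - i)).
Proof.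
rewrite /scoef coef_poly ltn_predRL; case: leqP => // le_fg_k1.
rewrite big1 // => i _.
have [lf_i|lt_i_f] := leqP (size (skewcoefs f)) i.
  by rewrite [_`_i]nth_default ?mul0r.
rewrite [X in iter i sigma X]nth_default ?iter_sigma0 ?mulr0 //.
by rewrite leq_subRL -ltnS // (leq_trans _ le_fg_k1) // ltn_add2r.
Qed.

Lemma scoef_mul_rev (f g : S) k :
  scoef (skew_mul f g) k
    = \sum_(i < k.+1) scoef f (k - i) * iter (k - i) sigma (scoef g i).
Proof.
rewrite scoef_mul (reindex_inj rev_ord_inj) /=.
by apply: eq_bigr => i _; rewrite (sub_ordK i).
Qed.

Lemma scoef_one i : scoef skew_one i = (i == 0%N)%:R.
Proof. exact: coef1. Qed.

Fact skew_mulA : associative skew_mul.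
Proof.
move=> f g h; apply: scoefP => k; rewrite scoef_mul scoef_mul_rev.
pose c3 j m := scoef f j
  * (iter j sigma (scoef g (k - j - m)) * iter (k - m) sigma (scoef h m)).
transitivity (\sum_(j < k.+1) \sum_(m < k.+1 | (m <= k - j)%N) c3 j m).
  apply: eq_bigr => /= j _; rewrite scoef_mul_rev iter_sigma_sum big_distrr /=.
  rewrite (big_ord_narrow_leq (leq_subr _ _)); apply: eq_bigr => m _ /=.
  rewrite iter_sigmaM -iterD /c3; congr (_ * (_ * iter _ _ _)).
  have lem : (m <= k - j)%N by rewrite -ltnS.
  by rewrite addnBA // subnKC // -ltnS.
rewrite (exchange_big_dep predT) //=; apply: eq_bigr => m _.
transitivity (\sum_(j < k.+1 | (j <= k - m)%N) c3 j m).
  apply: eq_bigl => j; rewrite -ltnS -(ltnS j) -!subSn ?leq_ord //.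
  by rewrite -subn_gt0 -(subn_gt0 j) -!subnDA addnC.
rewrite (big_ord_narrow_leq (leq_subr _ _)) scoef_mul big_distrl /=.
by apply: eq_bigr => j _; rewrite /c3 -!subnDA addnC mulrA.
Qed.

Fact skew_mul1s : left_id skew_one skew_mul.
Proof.
move=> f; apply: scoefP => k; rewrite scoef_mul big_ord_recl /= subn0.
rewrite scoef_one mul1r big1 ?addr0 // => i _.
by rewrite scoef_one mul0r.
Qed.

Fact skew_muls1 : right_id skew_one skew_mul.
Proof.
move=> f; apply: scoefP => k; rewrite scoef_mul_rev big_ord_recl /= subn0.
rewrite scoef_one iter_sigma1 mulr1 big1 ?addr0 // => i _.
by rewrite scoef_one iter_sigma0 mulr0.
Qed.

Fact skew_mulDl : left_distributive skew_mul +%R.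
Proof.
move=> f g h; apply: scoefP => k; rewrite scoefD !scoef_mul -big_split /=.
by apply: eq_bigr => i _; rewrite scoefD mulrDl.
Qed.

Fact skew_mulDr : right_distributive skew_mul +%R.
Proof.
move=> f g h; apply: scoefP => k; rewrite scoefD !scoef_mul -big_split /=.
by apply: eq_bigr => i _; rewrite scoefD iter_sigmaD mulrDr.
Qed.

Fact skew_one_neq0 : skew_one != 0.
Proof. by rewrite -val_eqE /= oner_eq0. Qed.

HB.instance Definition _ := GRing.Zmodule_isNzRing.Build S
  skew_mulA skew_mul1s skew_muls1 skew_mulDl skew_mulDr skew_one_neq0.

Lemma scoefM (f g : S) k :
  scoef (f * g) k = \sum_(i < k.+1) scoef f i * iter i sigma (scoef g (k - i)).
Proof. exact: scoef_mul. Qed.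

Lemma scoefM_rev (f g : S) k :
  scoef (f * g) k
    = \sum_(i < k.+1) scoef f (k - i) * iter (k - i) sigma (scoef g i).
Proof. exact: scoef_mul_rev. Qed.

Lemma scoef1 i : scoef (1 : S) i = (i == 0%N)%:R.
Proof. exact: coef1. Qed.

Fact skew_scaleAl (a : R) (f g : S) : a *: (f * g) = a *: f * g.
Proof.
apply: scoefP => k; rewrite scoefZ !scoefM big_distrr /=.
by apply: eq_bigr => i _; rewrite scoefZ mulrA.
Qed.

HB.instance Definition _ := GRing.Lmodule_isLalgebra.Build R S skew_scaleAl.

Lemma scoefXn n i : scoef (skewX ^+ n) i = (i == n)%:R.
Proof.
elim: n i => [|n IH] i; first by rewrite expr0 scoef1.
rewrite exprS scoefM; case: i => [|i].
  by rewrite big_ord_recl big_ord0 /scoef coefX mul0r addr0.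
rewrite (bigD1 (Ordinal (isT : (1 < i.+2)%N))) //= {1}/scoef coefX eqxx mul1r.
rewrite subn1 /= IH rmorph_nat eqSS big1 ?addr0 // => j.
by rewrite -val_eqE /= {1}/scoef coefX => /negPf ->; rewrite mul0r.
Qed.

Lemma skew_mulXn (a b : R) i j :
  (a *: skewX ^+ i) * (b *: skewX ^+ j)
    = (a * iter i sigma b) *: skewX ^+ (i + j) :> S.
Proof.
apply: scoefP => k; rewrite -skew_scaleAl !scoefZ -mulrA; congr (_ * _).
rewrite scoefM scoefXn; have [lt_k_i|le_i_k] := ltnP k i.
  rewrite big1 => [|l _]; last first.
    by rewrite scoefXn ltn_eqF ?mul0r // (leq_ltn_trans _ lt_k_i) // -ltnS.
  by rewrite ltn_eqF ?mulr0 // (leq_trans lt_k_i) ?leq_addr.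
rewrite (bigD1 (Ordinal (le_i_k : (i < k.+1)%N))) //= big1 => [|l].
  rewrite scoefXn eqxx mul1r addr0 scoefZ scoefXn iter_sigmaM.
  rewrite -(eqn_add2l i) subnKC //.
  by case: eqP => _; rewrite ?iter_sigma1 ?iter_sigma0.
by rewrite -val_eqE /= scoefXn => /negPf ->; rewrite mul0r.
Qed.

Lemma skewX_comm (a : R) : skewX * (a *: 1) = sigma a *: skewX.
Proof.
by have := skew_mulXn 1 a 1%N 0%N; rewrite expr1 expr0 scale1r mul1r.
Qed.

End SkewPolynomialRing.

Section Ideals.
Context {A : nzRingType}.

Record two_sided_ideal (J : A -> Prop) : Prop := TwoSidedIdeal {
  ideal0 : J 0;
  idealD : forall x y, J x -> J y -> J (x + y);
  idealMl : forall a x, J x -> J (a * x);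
  idealMr : forall a x, J x -> J (x * a)
}.

Definition ideal_gen (G : A -> Prop) (x : A) : Prop :=
  forall J, two_sided_ideal J -> (forall g, G g -> J g) -> J x.

Definition is_basis (G J : A -> Prop) : Prop :=
  forall x, J x <-> ideal_gen G x.

End Ideals.

Notation mon := {cmonom nat}.
(* Mon(S): (m, i) stands for the monomial m s^i *)
Notation smon := (mon * nat)%type.
Notation polyring K := {malg K[mon]}.

Definition mlcm (m n : mon) : mon :=
  [cmonom maxn (m i) (n i) | i in (finsupp m `|` finsupp n)%fset]%M.

Lemma mlcmE m n i : mlcm m n i = maxn (m i) (n i).
Proof.
rewrite cmE fsfun_fun in_fsetE.
by case: (finsuppP m); case: (finsuppP n); rewrite ?maxn0.
Qed.

(* 1 is a greatest common divisor of a and b *)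
Definition gcd_is_1 (A : comNzRingType) (a b : A) : Prop :=
  forall d, (exists u, a = d * u) -> (exists v, b = d * v) ->
  exists w, 1 = d * w.

Section Sigma.
Context {K : fieldType}.
Local Notation P := (polyring K).
Variable sigma : {rmorphism P -> P}.

Definition monomial_preserving : Prop :=
  forall m : mon, exists n : mon, sigma << m >> = << n >>.

(* the powers of sigma are pairwise distinct *)
Definition infinite_order : Prop :=
  forall i j, iter i sigma =1 iter j sigma -> i = j.

Definition coprime_on_vars : Prop :=
  forall i j : nat, i != j -> gcd_is_1 (sigma << ucm i >>) (sigma << ucm j >>).

(* the monomial with sigma << m >> = << sigma_mon m >>, when sigma preserves
   monomials *)
Definition sigma_mon (m : mon) : mon :=
  head mone (enum_fset (msupp (sigma << m >>))).

Lemma head_fset1 (T : choiceType) (x0 x : T) :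
  head x0 (enum_fset [fset x]%fset) = x.
Proof.
set s := enum_fset _.
have sP y : (y \in s) = (y == x) by rewrite -in_fset1.
case: s sP => [|y t] sP /=; first by have := sP x; rewrite eqxx.
by apply/eqP; rewrite -sP mem_head.
Qed.

Lemma sigma_monE m : monomial_preserving -> sigma << m >> = << sigma_mon m >>.
Proof.
move=> sigma_mono; rewrite /sigma_mon; have [n ->] := sigma_mono m.
by rewrite msuppU1 head_fset1.
Qed.

End Sigma.

Section MonomialsOfS.
Context {K : fieldType}.
Local Notation P := (polyring K).
Context {sigma : {rmorphism P -> P}}.
Local Notation S := (skewpoly sigma).

Definition smon_elt (v : smon) : S := (<< v.1 >> : P) *: skewX sigma ^+ v.2.

Definition smon_mul (v w : smon) : smon :=
  (mmul v.1 (iter v.2 (sigma_mon sigma) w.1), (v.2 + w.2)%N).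

Lemma smon_eltM v w : monomial_preserving sigma ->
  smon_elt v * smon_elt w = smon_elt (smon_mul v w).
Proof.
move=> sigma_mono; rewrite /smon_elt skew_mulXn; congr (_ *: _).
have -> : iter v.2 sigma << w.1 >> = << iter v.2 (sigma_mon sigma) w.1 >>.
  elim: {v}(v.2) => [|n IHn]; first by [].
  by rewrite !iterS IHn; apply: sigma_monE.
by rewrite malgM_def fgmulUU mulr1.
Qed.

(* the monomials occurring in f *)
Definition smon_supp (f : S) : seq smon :=
  [seq (m, i) | i <- iota 0 (size (skewcoefs f)),
                m <- enum_fset (msupp (scoef f i))].

Section Ordering.
Variable le : rel smon.

Definition smon_lt (v w : smon) : bool := (v != w) && le v w.

Record monomial_ordering : Prop := MonomialOrdering {
  mo_total : total le;
  mo_anti : antisymmetric le;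
  mo_trans : transitive le;
  mo_wf : well_founded smon_lt;
  mo_mul : forall v w p q, smon_lt v w ->
    smon_lt (smon_mul (smon_mul p v) q) (smon_mul (smon_mul p w) q)
}.

(* leading monomial and coefficient of f, for f != 0 (junk values at f = 0) *)
Definition lm (f : S) : smon := last (mone, 0%N) (sort le (smon_supp f)).
Definition lc (f : S) : K := (scoef f (lm f).2)@_(lm f).1.

(* lm(A), as a subset of S *)
Definition lm_set (A : S -> Prop) (x : S) : Prop :=
  exists f, [/\ A f, f != 0 & x = smon_elt (lm f)].

Definition groebner_basis (G J : S -> Prop) : Prop :=
  (forall g, G g -> J g) /\
  (forall x, ideal_gen (lm_set G) x <-> ideal_gen (lm_set J) x).

(* only meaningful for f, g != 0 with lm f and lm g of the same s-degree; divcm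
   is the quotient of monomials *)
Definition spoly (f g : S) : S :=
  let m := (lm f).1 in let n := (lm g).1 in let l := mlcm m n in
  (<< (lc f)^-1 *g divcm l m >> : P) *: f
    - (<< (lc g)^-1 *g divcm l n >> : P) *: g.

(* When h = 0, lm h is junk, but the empty representation r = [::] applies
   anyway. P is embedded in S by a |-> a%:A. *)
Definition groebner_repr (G : S -> Prop) (h : S) : Prop :=
  exists r : seq (P * S),
    h = \sum_(p <- r) p.1 *: p.2 /\
    forall p, p \in r ->
      [/\ p.1 != 0, G p.2, p.2 != 0
        & le (smon_mul (lm p.1%:A) (lm p.2)) (lm h)].

End Ordering.

Definition shomogeneous (f : S) : Prop :=
  exists i (a : P), f = a *: skewX sigma ^+ i.

(* J is the direct sum of its intersections with the P s^i *)
Definition graded (J : S -> Prop) : Prop :=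
  forall f, J f -> forall i, J (scoef f i *: skewX sigma ^+ i).

Definition Sigma_closure (G : S -> Prop) (h : S) : Prop :=
  exists g i j, G g /\ h = skewX sigma ^+ i * g * skewX sigma ^+ j.

End MonomialsOfS.

Arguments monomial_ordering {K} sigma le.
Arguments smon_mul {K} sigma v w.

(* Main.v *)
(* Since the elements of G are homogeneous, g p = sigma^d(p) g for p in P, so
   the ideal J is the left P-module spanned by Sigma G Sigma, and G is a Groebner
   basis of J exactly when lm(h) is a P-multiple of some lm(s^i g s^j) for every
   nonzero h in J. One direction is division by Sigma G Sigma. For the other,
   Buchberger's argument needs all S-polynomials of pairs s^i f s^j, s^k g s^l;
   as sigma preserves lcms of monomials (by coprimality), such an S-polynomial
   is s^a h s^b where h is one of those in the criterion, and multiplying a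
   Groebner representation of h by s^a and s^b gives one again. *)
Require Import Defs.
From HB Require Import structures.
From mathcomp Require Import all_boot all_order all_algebra finmap zify.
From mathcomp.multinomials Require Import monalg.
Set Implicit Arguments.
Unset Strict Implicit.
Unset Printing Implicit Defensive.
Import GRing.Theory.
Local Open Scope ring_scope.


(** * Divisibility and least common multiples of monomials of [P] *)

Section Monomials.

Lemma monP (m n : mon) : m =1 n -> m = n.
Proof. by move=> mn; apply/eqP/cmP. Qed.

Lemma mmul_divcm (m n : mon) : (forall i, n i <= m i)%N -> mmul n (divcm m n) = m.
Proof. by move=> le_nm; apply: monP => i; rewrite cmM divcmE subnKC. Qed.

Lemma divcm_mmul (m n : mon) : divcm (mmul m n) n = m.
Proof. by apply: monP => i; rewrite divcmE cmM addnK. Qed.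

Lemma mmul_inj (n : mon) : injective (mmul n).
Proof.
by move=> a b /(congr1 (fun x : mon => divcm x n)); rewrite ![mmul n _]mulmC !divcm_mmul.
Qed.

Lemma mlcm_mmul (m n a b : mon) :
  mmul a m = mmul b n -> exists u, mmul a m = mmul u (mlcm m n).
Proof.
move=> eq_ab; exists (divcm (mmul a m) (mlcm m n)).
rewrite [RHS]mulmC mmul_divcm // => i.
by rewrite mlcmE geq_max {2}eq_ab !cmM !leq_addl.
Qed.

(** Induction on the total degree: a monomial other than 1 has a variable in its support, which is
    split off. *)
Lemma mon_ind (Q : mon -> Prop) :
  Q mone -> (forall i m, Q m -> Q (mmul (ucm i) m)) -> forall m, Q m.
Proof.
move=> Q1 QS m; have [d] := ubnP (mdeg m); elim: d m => // d IHd m.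
have [->//|m_neq1] := eqVneq m mone.
have [i m_i] : exists i, m i != 0%N.
  case: (fset_0Vmem (finsupp m)) => [m0|[i]]; last by rewrite -cmE_neq0; exists i.
  by move: m_neq1; rewrite -mdeg_eq0 mdegE m0 big_seq_fset0.
have defm : mmul (ucm i) (divcm m (ucm i)) = m.
  by apply: mmul_divcm => j; rewrite cmU; case: eqP => // <-; rewrite lt0n.
rewrite -defm mdegM mdegU add1n ltnS => /IHd; exact: QS.
Qed.

End Monomials.

(* [term], like [sigm], [smul], [sterm] and [scf] below, is locked because
   unification otherwise compares distinct terms by unfolding them to finite maps,
   which does not end. *)
HB.lock Definition term (K : fieldType) (c : K) (m : mon) : polyring K :=
  << c *g m >>.
Arguments term {K}.

HB.lock Definition sigm (K : fieldType)
    (sigma : {rmorphism polyring K -> polyring K}) (m : mon) : mon :=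
  sigma_mon sigma m.
Arguments sigm {K}.

(** * Terms of [P] *)

Section Terms.
Context {K : fieldType}.
Local Notation P := (polyring K).

Lemma termE (c : K) m : << c *g m >> = term c m :> P.
Proof. by rewrite term.unlock. Qed.

Lemma coef_term (c : K) (m n : mon) : (term c m)@_n = c *+ (m == n).
Proof. rewrite -termE; exact: mcoeffU. Qed.

Lemma term1_inj : injective (@term K 1).
Proof.
move=> m n /= /(congr1 (fun p : P => p@_n)); rewrite !coef_term eqxx.
by case: eqP => // _ /eqP; rewrite eq_sym oner_eq0.
Qed.

Lemma termM (c d : K) m n : term c m * term d n = term (c * d) (mmul m n).
Proof. rewrite -!termE malgM_def; exact: fgmulUU. Qed.

Lemma termZ (c : K) m : term c m = c *: term 1 m.
Proof. by apply/malgP => n; rewrite mcoeffZ !coef_term mulr_natr. Qed.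

Lemma term1 : term 1 mone = 1 :> P.
Proof. by rewrite -termE. Qed.

End Terms.

(** * The action of [sigma] on monomials, up to its compatibility with lcms *)

Section SigmaMonomials.
Context {K : fieldType}.
Local Notation P := (polyring K).
Variable sigma : {rmorphism P -> P}.
Hypothesis sigma_mono : monomial_preserving sigma.
Local Notation sm := (sigm sigma).

Lemma sigma_term1 m : sigma (term 1 m) = term 1 (sm m).
Proof. rewrite -!termE sigm.unlock; exact: sigma_monE. Qed.

Lemma sigma_mkmalgU m : sigma << m >> = term 1 (sm m).
Proof. by rewrite -sigma_term1 -termE. Qed.

Lemma sigm1 : sm mone = mone.
Proof. by apply: (@term1_inj K); rewrite -sigma_term1 term1 rmorph1. Qed.

Lemma sigmM m n : sm (mmul m n) = mmul (sm m) (sm n).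
Proof.
apply: (@term1_inj K); rewrite -sigma_term1.
have mulU a b : term 1 (mmul a b) = term 1 a * term 1 b :> P.
  by rewrite termM mulr1.
by rewrite !mulU rmorphM /= !sigma_term1.
Qed.

Lemma iter_sigmM i m n :
  iter i sm (mmul m n) = mmul (iter i sm m) (iter i sm n).
Proof. by elim: i => //= i ->; rewrite sigmM. Qed.

Lemma iter_sigm1 i : iter i sm mone = mone.
Proof. by elim: i => //= i ->; rewrite sigm1. Qed.

Hypothesis sigma_scalable : scalable sigma.

Lemma iter_sigma_term i c m : iter i sigma (term c m) = term c (iter i sm m).
Proof.
elim: i => //= i ->.
rewrite (termZ c (iter _ _ _)) (termZ c (sm _)) -sigma_term1.
exact: sigma_scalable.
Qed.

Hypothesis sigma_coprime : coprime_on_vars sigma.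

(* A variable dividing both images would be a nonunit common divisor. *)
Lemma sigma_ucm_disjoint i j k : i != j -> sm (ucm i) k != 0%N -> sm (ucm j) k = 0%N.
Proof.
move=> ij si; apply: contraTeq isT => sj.
have dvdU (m : mon) : m k != 0%N -> exists u : P, term 1 m = term 1 (ucm k) * u.
  move=> mk; exists (term 1 (divcm m (ucm k))).
  rewrite termM mulr1 mmul_divcm // => l.
  by rewrite cmU; case: eqP => // <-; rewrite lt0n.
have [] := sigma_coprime ij (d := term 1 (ucm k)).
- by rewrite (sigma_mkmalgU (ucm i)); apply: dvdU.
- by rewrite (sigma_mkmalgU (ucm j)); apply: dvdU.
(* Compare constant coefficients in [1 = x_k w]: every monomial on the right is a multiple of
   [x_k]. *)
move=> w /(congr1 (fun p : P => p@_(mone : mon))).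
rewrite -term1 coef_term eqxx (monalgE w) big_distrr /=.
rewrite (@raddf_sum _ _ (mcoeff (mone : mon))) /= big1 => [|m _].
  by move/eqP; rewrite oner_eq0.
rewrite termE termM coef_term.
by case: eqP => // /eqP; rewrite cmM_eq1 cm1_eq1.
Qed.

(** The image of [m] is the product of the images of its variables, so its exponent at [k] is a sum
    of zeros. *)
Lemma sigm_notin k (m : mon) :
  (forall i, i \in finsupp m -> sm (ucm i) k = 0%N) -> sm m k = 0%N.
Proof.
elim/mon_ind: m => [|i m IHm] s0; first by rewrite sigm1 cm1.
rewrite sigmM cmM s0 ?IHm // => [j mj|]; last by rewrite mdomD mdomU !inE eqxx.
by rewrite s0 // mdomD inE mj orbT.
Qed.

(** Exponents at [k] add up over the variables of [m]; by disjointness of the images only the copies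
    of [x_i] contribute. *)
Lemma sigm_var i k (m : mon) :
  sm (ucm i) k != 0%N -> sm m k = (m i * sm (ucm i) k)%N.
Proof.
move=> si; elim/mon_ind: m => [|j m IHm]; first by rewrite sigm1 !cm1.
rewrite sigmM !cmM IHm cmU mulnDl; congr addn.
case: eqVneq => [->|ji]; first by rewrite mul1n.
by rewrite (sigma_ucm_disjoint _ si) // eq_sym.
Qed.

(* By coprimality, a variable divides the image of at most one variable, so
   each exponent of [sm m] is a multiple of a single exponent of [m]. *)
Lemma sigm_lcm m n : sm (mlcm m n) = mlcm (sm m) (sm n).
Proof.
apply: monP => k; rewrite mlcmE.
have [/hasP[i _ si]|/hasPn s0] :=
  boolP (has (fun i => sm (ucm i) k != 0%N) (finsupp (mlcm m n))).
  rewrite (sigm_var (mlcm m n) si) (sigm_var m si) (sigm_var n si) -maxnMl.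
  by congr muln; apply: mlcmE.
(* In this case no variable of the lcm has [x_k] in its image, so all three images have exponent 0
   at [k]. *)
have s0' i : mlcm m n i != 0%N -> sm (ucm i) k = 0%N.
  by rewrite cmE_neq0 => /s0/negbNE/eqP.
have s0'' (p : mon) : (forall i, p i <= mlcm m n i)%N -> sm p k = 0%N.
  move=> le_p; apply: sigm_notin => i; rewrite -cmE_neq0 -lt0n => pi.
  by apply: s0'; rewrite -lt0n (leq_trans pi).
by rewrite !s0'' // => i; rewrite mlcmE ?leq_maxl ?leq_maxr.
Qed.

Lemma iter_sigm_lcm i m n :
  iter i sm (mlcm m n) = mlcm (iter i sm m) (iter i sm n).
Proof. by elim: i => //= i ->; rewrite sigm_lcm. Qed.

End SigmaMonomials.

HB.lock Definition smul (K : fieldType)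
    (sigma : {rmorphism polyring K -> polyring K}) (v w : smon) : smon :=
  smon_mul sigma v w.
Arguments smul {K}.

HB.lock Definition sterm (K : fieldType)
    (sigma : {rmorphism polyring K -> polyring K}) (c : K) (v : smon) :
    skewpoly sigma :=
  term c v.1 *: skewX sigma ^+ v.2.
Arguments sterm {K}.

HB.lock Definition scf (K : fieldType)
    (sigma : {rmorphism polyring K -> polyring K}) (f : skewpoly sigma)
    (v : smon) : K :=
  (scoef f v.2)@_v.1.
Arguments scf {K sigma}.

(** * Terms and coefficients in the skew polynomial ring *)

Section SkewTerms.
Context {K : fieldType}.
Local Notation P := (polyring K).
Variable sigma : {rmorphism P -> P}.
Local Notation S := (skewpoly sigma).
Local Notation sm := (sigm sigma).
Local Notation smul := (smul sigma).
Local Notation sterm := (sterm sigma).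

Lemma smulE v w : smul v w = (mmul v.1 (iter v.2 sm w.1), (v.2 + w.2)%N).
Proof.
rewrite smul.unlock /smon_mul; congr (mmul _ _, _).
by elim: v.2 => //= i ->; rewrite sigm.unlock.
Qed.

Lemma smon_mulE v w : smon_mul sigma v w = smul v w.
Proof. by rewrite smul.unlock. Qed.

Lemma smon_eltE v : smon_elt v = sterm 1 v.
Proof. by rewrite sterm.unlock /smon_elt termE. Qed.

Lemma scfE (f : S) m i : (scoef f i)@_m = scf f (m, i).
Proof. by rewrite scf.unlock. Qed.

Lemma scfD (f g : S) v : scf (f + g) v = scf f v + scf g v.
Proof. by rewrite scf.unlock scoefD; apply: mcoeffD. Qed.

Lemma scf0 v : scf (0 : S) v = 0.
Proof. by rewrite scf.unlock /scoef coef0; apply: mcoeff0. Qed.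

Lemma scfN (f : S) v : scf (- f) v = - scf f v.
Proof. by apply/eqP; rewrite -addr_eq0 -scfD addNr scf0. Qed.

Lemma scf_sum I r (Q : pred I) (F : I -> S) v :
  scf (\sum_(i <- r | Q i) F i) v = \sum_(i <- r | Q i) scf (F i) v.
Proof. by apply: (big_morph (fun f => scf f v) _ (scf0 v)) => f g; apply: scfD. Qed.

Lemma scfP (f g : S) : (forall v, scf f v = scf g v) -> f = g.
Proof.
by move=> fg; apply: scoefP => i; apply/malgP => m; rewrite !scfE.
Qed.

Lemma scf_sterm c v w : scf (sterm c v) w = c *+ (v == w).
Proof.
rewrite scf.unlock sterm.unlock scoefZ scoefXn.
case: v w => [m i] [n j] /=; rewrite xpair_eqE [j == i]eq_sym.
case: eqP => _; first by rewrite andbT mulr1 coef_term.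
by rewrite andbF mulr0 mcoeff0.
Qed.

Lemma smon_suppE (f : S) v : (v \in smon_supp f) = (scf f v != 0).
Proof.
rewrite scf.unlock; case: v => m i /=; apply/allpairsPdep/idP => /=.
  by case=> j [n [_ fn [-> ->]]]; rewrite mcoeff_neq0.
move=> fm; exists i, m; split => //; last by rewrite mcoeff_neq0 in fm.
rewrite mem_iota add0n leq0n ltnNge /=; apply: contra fm => le_fi.
by rewrite /scoef nth_default // mcoeff0.
Qed.

Lemma sterm_sum (f : S) : f = \sum_(v <- smon_supp f) sterm (scf f v) v.
Proof.
rewrite /smon_supp big_allpairs_dep /=.
have defX i : \sum_(m <- enum_fset (msupp (scoef f i))) sterm (scf f (m, i)) (m, i)
    = scoef f i *: skewX sigma ^+ i.
  rewrite [in RHS](monalgE (scoef f i)) scaler_suml; apply: eq_bigr => m _.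
  by rewrite -scfE termE sterm.unlock.
rewrite (eq_bigr _ (fun i _ => defX i)); apply: scoefP => j.
rewrite (big_morph (fun g : S => scoef g j) (id1 := 0) (op1 := +%R)); first last.
- by rewrite /scoef coef0.
- by move=> g h; apply: scoefD.
(* Only the index [j] contributes to the coefficient at [j]. If [j] is beyond the size there is no
   such index, and the coefficient is 0 by default. *)
rewrite (eq_bigr (fun i => if i == j then scoef f i else 0)) => [|i _]; last first.
  by rewrite scoefZ scoefXn eq_sym; case: eqP; rewrite ?mulr1 ?mulr0.
rewrite -big_mkcond /=; have [lt_jf|le_fj] := ltnP j (size (skewcoefs f)).
  rewrite -big_filter (@filter_pred1_uniq _ _ j) ?iota_uniq ?mem_iota //.
  by rewrite big_seq1.
rewrite big_seq_cond big1 => [|i]; first by rewrite /scoef nth_default.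
rewrite mem_iota => /andP[/andP[_ lt_if] /eqP eq_ij].
by move: lt_if; rewrite add0n eq_ij ltnNge le_fj.
Qed.

Lemma size_smon_supp0 (f : S) : f != 0 -> smon_supp f != [::].
Proof.
by apply: contraNneq => f0; rewrite (sterm_sum f) f0 big_nil.
Qed.

Hypothesis sigma_mono : monomial_preserving sigma.
Hypothesis sigma_scalable : scalable sigma.

Lemma stermM c d v w : sterm c v * sterm d w = sterm (c * d) (smul v w).
Proof. by rewrite sterm.unlock smulE skew_mulXn iter_sigma_term // termM. Qed.

Lemma smulA v w u : smul v (smul w u) = smul (smul v w) u.
Proof.
by rewrite !smulE /= iter_sigmM // iterD addnA mulmA.
Qed.

Lemma smul1 v : smul (mone, 0%N) v = v.
Proof. by rewrite smulE /= mul1m; case: v. Qed.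

Lemma smuls1 v : smul v (mone, 0%N) = v.
Proof. by rewrite smulE /= iter_sigm1 // mulm1 addn0; case: v. Qed.

Lemma smulX i j v : smul (smul (mone, i) v) (mone, j) = (iter i sm v.1, (i + v.2 + j)%N).
Proof. by rewrite !smulE /= mul1m iter_sigm1 // mulm1. Qed.

Lemma stermX i : sterm 1 (mone, i) = skewX sigma ^+ i.
Proof. by rewrite sterm.unlock /= term1 scale1r. Qed.

Lemma scaler_sterm c m (f : S) : term c m *: f = sterm c (m, 0%N) * f.
Proof. by rewrite sterm.unlock /= expr0 -skew_scaleAl mul1r. Qed.

(** The commutation rule [s^i a = sigma^i(a) s^i], which lets coefficients in [P] be moved to the
    left. *)
Lemma mulX_scaler i (a : P) (f : S) :
  sterm 1 (mone, i) * (a *: f) = iter i sigma a *: (sterm 1 (mone, i) * f).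
Proof.
have Xa : skewX sigma ^+ i * a%:A = iter i sigma a *: skewX sigma ^+ i.
  by have := @skew_mulXn _ sigma 1 a i 0; rewrite expr0 scale1r mul1r addn0.
rewrite stermX skew_scaleAl -[in LHS](mul1r f) skew_scaleAl.
by rewrite (mulrA (skewX sigma ^+ i)) Xa.
Qed.

End SkewTerms.

Lemma path_le_last (T : eqType) (r : rel T) (x : T) (s : seq T) :
  reflexive r -> transitive r -> path r x s ->
  forall y, y \in x :: s -> r y (last x s).
Proof.
move=> r_refl r_trans; elim: s x => [|z s IHs] x /=.
  by move=> _ y; rewrite inE => /eqP->.
case/andP=> r_xz r_zs y; rewrite inE => /predU1P[->|]; last exact: IHs.
by apply: r_trans r_xz (IHs _ r_zs _ _); rewrite mem_head.
Qed.

(** * Leading monomials under a monomial ordering *)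

Section MonomialOrder.
Context {K : fieldType}.
Local Notation P := (polyring K).
Variable sigma : {rmorphism P -> P}.
Local Notation S := (skewpoly sigma).
Local Notation sm := (sigm sigma).
Local Notation "v ** w" := (smul sigma v w) (at level 40, left associativity).
Local Notation sterm := (sterm sigma).
Hypothesis sigma_mono : monomial_preserving sigma.
Hypothesis sigma_scalable : scalable sigma.
Variable le : rel smon.
Hypothesis le_mo : monomial_ordering sigma le.
Local Notation lt := (smon_lt le).

Lemma le_refl v : le v v.
Proof. by have := mo_total le_mo v v; rewrite orbb. Qed.

Lemma ltW v w : lt v w -> le v w.
Proof. by case/andP. Qed.

Lemma lt_irr v : lt v v = false.
Proof. by rewrite /smon_lt eqxx. Qed.

Lemma lt_total v w : v != w -> lt v w \/ lt w v.
Proof.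
move=> vw; have /orP[le_vw|le_wv] := mo_total le_mo v w; [left|right].
  by rewrite /smon_lt vw.
by rewrite /smon_lt eq_sym vw.
Qed.

Lemma le_anti v w : le v w -> le w v -> v = w.
Proof. by move=> vw wv; apply: (mo_anti le_mo); rewrite vw. Qed.

Lemma le_trans u v w : le u v -> le v w -> le u w.
Proof. exact: (mo_trans le_mo). Qed.

Lemma le_lt_trans u v w : le u v -> lt v w -> lt u w.
Proof.
move=> le_uv /andP[vw le_vw]; apply/andP; split; last exact: le_trans le_uv le_vw.
by apply: contraNneq vw => eq_uw; rewrite eq_uw in le_uv *; rewrite (le_anti le_uv).
Qed.

Lemma lt_smul p q v w : lt v w -> lt (p ** v ** q) (p ** w ** q).
Proof. by move/(mo_mul le_mo p q); rewrite !smon_mulE. Qed.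

Lemma le_smul p q v w : le v w -> le (p ** v ** q) (p ** w ** q).
Proof.
have [-> _|vw] := eqVneq v w; first exact: le_refl.
by move=> le_vw; apply: ltW; apply: lt_smul; rewrite /smon_lt vw.
Qed.

Lemma le_smulr q v w : le v w -> le (v ** q) (w ** q).
Proof. by move/(le_smul (mone, 0%N) q); rewrite !smul1. Qed.

Lemma le_smull p v w : le v w -> le (p ** v) (p ** w).
Proof. by move/(le_smul p (mone, 0%N)); rewrite !smuls1. Qed.

(** Distinct monomials are comparable, and strict monotonicity of products keeps their images
    distinct. *)
Lemma smul_inj p q : injective (fun v => p ** v ** q).
Proof.
move=> v w /= eq_pq; apply/eqP; apply/negP => /negP /lt_total[] /(lt_smul p q).
  by rewrite eq_pq lt_irr.
by rewrite eq_pq lt_irr.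
Qed.

Section Multiply.
Variables (c d : K) (p q : smon).

Let mulE (h : S) : sterm c p * h * sterm d q =
  \sum_(v <- smon_supp h) sterm (c * scf h v * d) (p ** v ** q).
Proof.
rewrite {1}(sterm_sum h) big_distrr big_distrl /=; apply: eq_bigr => v _.
by rewrite !stermM.
Qed.

(** By [smul_inj], no two monomials of [h] merge under multiplication by terms. *)
Lemma scf_smul (h : S) v :
  scf (sterm c p * h * sterm d q) (p ** v ** q) = c * scf h v * d.
Proof.
rewrite mulE scf_sum [in RHS](sterm_sum h) scf_sum big_distrr big_distrl /=.
apply: eq_bigr => w _; rewrite !scf_sterm (inj_eq (@smul_inj p q)).
by case: eqP; rewrite ?mulr1n ?mulr0n ?mulr0 ?mul0r.
Qed.

Lemma scf_smul_ex (h : S) w :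
  scf (sterm c p * h * sterm d q) w != 0 ->
  exists2 v, scf h v != 0 & w = p ** v ** q.
Proof.
move=> hw; have [/hasP[v hv /eqP->]|/hasPn no] :=
  boolP (has (fun v => w == p ** v ** q) (smon_supp h)).
  by exists v; rewrite -?smon_suppE.
case/eqP: hw; rewrite mulE scf_sum big_seq big1 // => v /no.
by rewrite scf_sterm eq_sym => /negPf->.
Qed.

End Multiply.

Lemma lm_spec (f : S) : f != 0 ->
  scf f (lm le f) != 0 /\ forall v, scf f v != 0 -> le v (lm le f).
Proof.
move=> f0; rewrite -smon_suppE /lm.
have s_sorted := sort_sorted (mo_total le_mo) (smon_supp f).
have mem_s := mem_sort le (smon_supp f).
case: (sort le _) s_sorted mem_s => [|x s] /= x_path mem_s.
  have := size_smon_supp0 f0; case: (smon_supp f) mem_s => // v t /(_ v).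
  by rewrite mem_head.
split=> [|v]; first by rewrite -mem_s mem_last.
rewrite -smon_suppE -mem_s; apply: path_le_last x_path _.
  exact: le_refl.
exact: (mo_trans le_mo).
Qed.

Lemma scf_lm (f : S) : f != 0 -> scf f (lm le f) != 0.
Proof. by case/lm_spec. Qed.

Lemma le_lm (f : S) v : scf f v != 0 -> le v (lm le f).
Proof.
move=> fv; have f0 : f != 0 by apply: contraNneq fv => ->; rewrite scf0.
by have [_] := lm_spec f0; apply.
Qed.

Lemma lm_uniq (f : S) v :
  scf f v != 0 -> (forall w, scf f w != 0 -> le w v) -> lm le f = v.
Proof.
move=> fv max_v; apply: le_anti (le_lm fv); apply: max_v.
by apply: scf_lm; apply: contraNneq fv => ->; rewrite scf0.
Qed.

Lemma lcE (f : S) : lc le f = scf f (lm le f).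
Proof. by rewrite scf.unlock. Qed.

(** Multiplication by powers of [s] transports the monomials of [f] monotonically and keeps their
    coefficients, so the leading one stays leading. *)
Lemma lm_mulX i j (f : S) : f != 0 ->
  let h := sterm 1 (mone, i) * f * sterm 1 (mone, j) in
  [/\ h != 0, lm le h = (iter i sm (lm le f).1, (i + (lm le f).2 + j)%N)
    & scf h (lm le h) = scf f (lm le f)].
Proof.
move=> f0 h; have scf_h v : scf h ((mone, i) ** v ** (mone, j)) = scf f v.
  by rewrite scf_smul mul1r mulr1.
have lmE : lm le h = (mone, i) ** lm le f ** (mone, j).
  apply: lm_uniq; first by rewrite scf_h scf_lm.
  by move=> w /scf_smul_ex[v fv ->]; apply/le_smul/le_lm.
have h_lm : scf h (lm le h) = scf f (lm le f) by rewrite lmE scf_h.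
split=> //; last by rewrite lmE smulX.
by apply: contraNneq (scf_lm f0) => h0; rewrite -h_lm h0 scf0.
Qed.

Lemma scf_scalar (a : P) m : scf (a%:A : S) (m, 0%N) = a@_m.
Proof. by rewrite -scfE scoefZ scoef1 mulr1. Qed.

Lemma sterm_ind (Q : S -> Prop) :
  Q 0 -> (forall f g, Q f -> Q g -> Q (f + g)) -> (forall c v, Q (sterm c v)) ->
  forall f, Q f.
Proof. by move=> Q0 QD Qt f; rewrite (sterm_sum f); apply: big_ind. Qed.

End MonomialOrder.

(* What the Groebner basis argument needs to know of S. It is carried out in an
   abstract ring, because unification unfolds the product of [skewpoly] and then
   does not end. *)
Record term_structure (K : fieldType)
    (sigma : {rmorphism polyring K -> polyring K}) (le : rel smon)
    (S : lalgType (polyring K)) (sterm : K -> smon -> S) (scf : S -> smon -> K)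
    (lm : S -> smon) : Prop := TermStructure {
  ts_scfD : forall f g v, scf (f + g) v = scf f v + scf g v;
  ts_scf0 : forall v, scf 0 v = 0;
  ts_scfP : forall f g, (forall v, scf f v = scf g v) -> f = g;
  ts_scf_sterm : forall c v w, scf (sterm c v) w = c *+ (v == w);
  ts_stermM : forall c d v w, sterm c v * sterm d w = sterm (c * d) (smul sigma v w);
  ts_sterm1 : sterm 1 (mone, 0%N) = 1;
  ts_scaler_sterm : forall c m f, term c m *: f = sterm c (m, 0%N) * f;
  ts_mulX_scaler : forall i a f,
    sterm 1 (mone, i) * (a *: f) = iter i sigma a *: (sterm 1 (mone, i) * f);
  ts_scf_scalar : forall a m, scf a%:A (m, 0%N) = a@_m;
  ts_ind : forall Q : S -> Prop, Q 0 -> (forall f g, Q f -> Q g -> Q (f + g)) ->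
    (forall c v, Q (sterm c v)) -> forall f, Q f;
  ts_scf_lm : forall f, f != 0 -> scf f (lm f) != 0;
  ts_le_lm : forall f v, scf f v != 0 -> le v (lm f);
  ts_scf_mul : forall c d p q f v,
    scf (sterm c p * f * sterm d q) (smul sigma (smul sigma p v) q)
      = c * scf f v * d;
  ts_scf_mul_ex : forall c d p q f w, scf (sterm c p * f * sterm d q) w != 0 ->
    exists2 v, scf f v != 0 & w = smul sigma (smul sigma p v) q;
  ts_lm_mulX : forall i j f, f != 0 ->
    let h := sterm 1 (mone, i) * f * sterm 1 (mone, j) in
    [/\ h != 0, lm h = (iter i (sigm sigma) (lm f).1, (i + (lm f).2 + j)%N)
      & scf h (lm h) = scf f (lm f)]
}.

(** * Buchberger's argument for left [P]-combinations of [Sigma G Sigma] *)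

Section SigmaCriterion.
Context {K : fieldType}.
Local Notation P := (polyring K).
Variable sigma : {rmorphism P -> P}.
Local Notation sm := (sigm sigma).
Local Notation "v ** w" := (smul sigma v w) (at level 40, left associativity).
Hypothesis sigma_mono : monomial_preserving sigma.
Hypothesis sigma_scalable : scalable sigma.
Hypothesis sigma_coprime : coprime_on_vars sigma.
Variable le : rel smon.
Hypothesis le_mo : monomial_ordering sigma le.
Local Notation lt := (smon_lt le).
Variables (S : lalgType P) (sterm : K -> smon -> S) (scf : S -> smon -> K).
Variable lm : S -> smon.
Hypothesis ts : term_structure sigma le sterm scf lm.
Local Notation X i := (sterm 1 (mone, i%N)).
Local Notation lc f := (scf f (lm f)).
Variable G : S -> Prop.

(** [SG], [has_repr] and [spol] are the counterparts in the abstract ring of [Sigma_closure],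
    [groebner_repr] and [spoly]. *)
Definition SG (h : S) := exists g i j, G g /\ h = X i * g * X j.

Definition has_repr (h : S) := exists r : seq (P * S),
  h = \sum_(p <- r) p.1 *: p.2 /\
  forall p, p \in r -> [/\ p.1 != 0, SG p.2, p.2 != 0
    & le (lm p.1%:A ** lm p.2) (lm h)].

Definition spol (f g : S) : S :=
  let m := (lm f).1 in let n := (lm g).1 in let l := mlcm m n in
  term (lc f)^-1 (divcm l m) *: f - term (lc g)^-1 (divcm l n) *: g.

(** The predicate [Q] constrains the leading monomial of each summand, not that of the sum, so it
    survives cancellation between summands. Coefficients are single terms, possibly zero. *)
Inductive span (Q : smon -> Prop) : S -> Prop :=
| span0 : span Q 0
| span_cons c t g h : SG g -> g != 0 -> Q ((t, 0%N) ** lm g) -> span Q h ->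
    span Q (sterm c (t, 0%N) * g + h).

Local Notation span_lt T := (span (fun v => lt v T)).
Local Notation span_le T := (span (fun v => le v T)).

Let scfN f v : scf (- f) v = - scf f v.
Proof. by apply/eqP; rewrite -addr_eq0 -(ts_scfD ts) addNr (ts_scf0 ts). Qed.

Let sterm0 v : sterm 0 v = 0.
Proof. by apply: (ts_scfP ts) => w; rewrite (ts_scf0 ts) (ts_scf_sterm ts) mul0rn. Qed.

Let stermN c v : sterm (- c) v = - sterm c v.
Proof. by apply: (ts_scfP ts) => w; rewrite scfN !(ts_scf_sterm ts) mulNrn. Qed.

Let stermD c d v : sterm (c + d) v = sterm c v + sterm d v.
Proof.
by apply: (ts_scfP ts) => w; rewrite (ts_scfD ts) !(ts_scf_sterm ts) mulrnDl.
Qed.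

Let X0 : X 0 = 1 := ts_sterm1 ts.

Let XD i j : X (i + j) = X i * X j.
Proof. by rewrite (ts_stermM ts) mulr1 smulE /= iter_sigm1 // mulm1. Qed.

Let scf_mull c p f v : scf (sterm c p * f) (p ** v) = c * scf f v.
Proof.
have := ts_scf_mul ts c 1 p (mone, 0%N) f v.
by rewrite X0 !mulr1 smuls1.
Qed.

Let scf_mull_ex c p f w : scf (sterm c p * f) w != 0 ->
  exists2 v, scf f v != 0 & w = p ** v.
Proof.
rewrite -[_ * f]mulr1 -X0 => /(ts_scf_mul_ex ts)[v fv ->].
by exists v; rewrite ?smuls1.
Qed.

Lemma span_mono (Q Q' : smon -> Prop) h :
  (forall v, Q v -> Q' v) -> span Q h -> span Q' h.
Proof.
move=> QQ'; elim=> [|c t g f Gg g0 Qg _ IHf]; first exact: span0.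
by apply: span_cons => //; apply: QQ'.
Qed.

Lemma span1 (Q : smon -> Prop) c t g :
  SG g -> g != 0 -> Q ((t, 0%N) ** lm g) -> span Q (sterm c (t, 0%N) * g).
Proof. by move=> Gg g0 Qg; rewrite -[_ * g]addr0; apply: span_cons Qg (span0 Q). Qed.

Lemma spanD Q f h : span Q f -> span Q h -> span Q (f + h).
Proof.
move=> Qf Qh; elim: Qf => [|c t g f' Gg g0 Qg _ IHf]; first by rewrite add0r.
by rewrite -addrA; apply: span_cons.
Qed.

Lemma spanN Q f : span Q f -> span Q (- f).
Proof.
elim=> [|c t g h Gg g0 Qg _ IHh]; first by rewrite oppr0; apply: span0.
by rewrite opprD -mulNr -stermN; apply: span_cons.
Qed.

Lemma SG_mulX i j g : SG g -> SG (X i * g * X j).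
Proof.
by case=> f [k [l [Gf ->]]]; exists f, (i + k)%N, (l + j)%N; rewrite !XD !mulrA.
Qed.

(** For [p = m s^i], the product [(c m s^i)(d t g) s^j] equals [c d m sigma^i(t) (s^i g s^j)], again
    a multiple of an element of [SG]. *)
Lemma span_mul (Q Q' : smon -> Prop) c p j h :
    (forall v, Q v -> Q' (p ** v ** (mone, j))) ->
  span Q h -> span Q' (sterm c p * h * X j).
Proof.
move=> QQ'; elim=> [|d t g f Gg g0 Qg _ IHf].
  by rewrite mulr0 mul0r; apply: span0.
rewrite mulrDr mulrDl; apply: spanD => //.
have [g'0 lm_g' _] := ts_lm_mulX ts p.2 j g0.
have -> : sterm c p * (sterm d (t, 0%N) * g) * X j =
    sterm (c * d) (mmul p.1 (iter p.2 sm t), 0%N) * (X p.2 * g * X j).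
  rewrite !mulrA !(ts_stermM ts) !smulE /=.
  by rewrite mulm1 mulr1 addn0 add0n.
apply: span1 => //; first exact: SG_mulX.
have := QQ' _ Qg; congr Q'; rewrite lm_g' !smulE /=.
by rewrite !iter_sigm1 // !iter_sigmM // !add0n mulm1 mulmA ?addnA.
Qed.

Lemma spanZ Q c h : span Q h -> span Q (sterm c (mone, 0%N) * h).
Proof.
move/(@span_mul Q Q c (mone, 0%N) 0%N); rewrite X0 mulr1; apply=> v.
by rewrite smul1 smuls1.
Qed.

Lemma scf_span_lt T h v : span_lt T h -> scf h v != 0 -> lt v T.
Proof.
elim=> [|c t g f Gg g0 ltgT _ IHf]; first by rewrite (ts_scf0 ts) eqxx.
rewrite (ts_scfD ts); have [->|f0 _] := eqVneq (scf f v) 0; last exact: IHf.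
rewrite addr0 => /scf_mull_ex[w gw ->].
by apply: (le_lt_trans le_mo) ltgT; apply/(le_smull sigma_mono le_mo)/(ts_le_lm ts).
Qed.

Lemma span_scale (Q : smon -> Prop) (a : P) g : SG g -> g != 0 ->
  (forall m, a@_m != 0 -> Q ((m, 0%N) ** lm g)) -> span Q (a *: g).
Proof.
move=> Gg g0 Qa; rewrite (monalgE a) scaler_suml big_seq.
apply: big_ind => [||m]; [exact: span0|exact: spanD|].
rewrite -mcoeff_neq0 => am; rewrite termE (ts_scaler_sterm ts).
by apply: span1 => //; apply: Qa.
Qed.

(** The bound on [lm h] is conditional because [lm 0] is a junk value; for [h = 0] the empty
    combination serves. *)
Lemma repr_span T h : has_repr h -> (h != 0 -> lt (lm h) T) -> span_lt T h.
Proof.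
case=> r [h_sum r_small]; have [-> _|h0 /(_ isT) lt_hT] := eqVneq h 0.
  exact: span0.
rewrite h_sum big_seq; apply: big_ind => [||p]; [exact: span0|exact: spanD|].
case/r_small=> _ Gp p0 le_ph; apply: span_scale => // m pm.
apply: (le_lt_trans le_mo) lt_hT; apply: (le_trans le_mo) le_ph.
apply: (le_smulr le_mo); apply: (ts_le_lm ts).
by rewrite (ts_scf_scalar ts).
Qed.

(* For every common multiple T of the leading monomials of a and b, the
   cancellation of T between multiples of a and b is a combination of multiples
   of elements of SG with leading monomials below T. *)
Definition spair a b := forall t t',
  (t, 0%N) ** lm a = (t', 0%N) ** lm b ->
  span_lt ((t, 0%N) ** lm a)
    (sterm (lc a)^-1 (t, 0%N) * a - sterm (lc b)^-1 (t', 0%N) * b).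

Lemma spair_sym a b : spair a b -> spair b a.
Proof. by move=> ab t t' eq_t; rewrite -opprB eq_t; apply/spanN/ab. Qed.

(** Both halves of the S-polynomial have leading monomial the lcm, with coefficient 1. These cancel,
    so a representation has all its summands below the lcm. *)
Lemma spol_span a b : a != 0 -> b != 0 -> (lm a).2 = (lm b).2 ->
    has_repr (spol a b) ->
  span_lt (mlcm (lm a).1 (lm b).1, (lm a).2) (spol a b).
Proof.
move=> a0 b0 eq_deg /repr_span; apply.
rewrite /spol !(ts_scaler_sterm ts) /=; set l := mlcm _ _ => h0.
have lmul f : (forall i, (lm f).1 i <= l i)%N -> (lm f).2 = (lm a).2 ->
    (l, (lm a).2) = (divcm l (lm f).1, 0%N) ** lm f.
  by move=> le_fl def; rewrite smulE /= add0n def mulmC mmul_divcm.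
have al : (l, (lm a).2) = (divcm l (lm a).1, 0%N) ** lm a.
  by apply: lmul => // i; rewrite mlcmE leq_maxl.
have bl : (l, (lm a).2) = (divcm l (lm b).1, 0%N) ** lm b.
  by apply: lmul => // i; rewrite mlcmE leq_maxr.
have small f v : scf (sterm (lc f)^-1 (divcm l (lm f).1, 0%N) * f) v != 0 ->
    (l, (lm a).2) = (divcm l (lm f).1, 0%N) ** lm f -> le v (l, (lm a).2).
  case/scf_mull_ex=> w fw -> ->.
  by apply/(le_smull sigma_mono le_mo)/(ts_le_lm ts).
have h_lm := ts_scf_lm ts h0; apply/andP; split.
  apply: contraNneq h_lm => ->; rewrite (ts_scfD ts) scfN {1}al bl.
  by rewrite !scf_mull !mulVf ?(ts_scf_lm ts) // subrr.
move: h_lm; rewrite {1}(ts_scfD ts) scfN.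
set v := lm (_ - _); have [->|ah _] :=
  eqVneq (scf (sterm (lc a)^-1 (divcm l (lm a).1, 0%N) * a) v) 0; last first.
  exact: (small a _ ah al).
rewrite add0r oppr_eq0 => bh; exact: (small b _ bh bl).
Qed.

(* The lcm is compatible with sigma, so that s^i spol(a, b) s^j is the
   S-polynomial of s^i a s^j and s^i b s^j. *)
Lemma spol_spair a b i j : a != 0 -> b != 0 -> (lm a).2 = (lm b).2 ->
  has_repr (spol a b) -> spair (X i * a * X j) (X i * b * X j).
Proof.
move=> a0 b0 eq_deg /(spol_span a0 b0 eq_deg).
rewrite /spol !(ts_scaler_sterm ts) /=; set l := mlcm _ _ => ab t t'.
have [_ lm_a lc_a] := ts_lm_mulX ts i j a0.
have [_ lm_b lc_b] := ts_lm_mulX ts i j b0.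
rewrite lc_a lc_b lm_a lm_b !smulE /= !add0n => -[eq_t _].
have [u] := mlcm_mmul eq_t; rewrite -iter_sigm_lcm // -/l => eq_u.
(* With [m = (lm f).1], cancelling [sigma^i(m)] in [x sigma^i(m) = u sigma^i(l)] gives
   [x = u sigma^i(l/m)], hence [x s^i f s^j = u s^i (l/m) f s^j]. *)
have shift f (x : mon) c : (forall k, (lm f).1 k <= l k)%N ->
    mmul x (iter i sm (lm f).1) = mmul u (iter i sm l) ->
    sterm c (x, 0%N) * (X i * f * X j) =
      sterm 1 (u, i) * (sterm c (divcm l (lm f).1, 0%N) * f) * X j.
  move=> le_fl eq_xu; rewrite !mulrA !(ts_stermM ts) !smulE /= mulr1 mul1r addn0.
  congr (sterm _ (_, _) * _ * _); rewrite mulm1.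
  apply: (@mmul_inj (iter i sm (lm f).1)); rewrite mulmC eq_xu.
  rewrite [RHS]mulmC -mulmA -iter_sigmM //; congr (mmul _ (iter _ _ _)).
  by rewrite mulmC mmul_divcm.
rewrite (shift a) //; last by move=> k; rewrite mlcmE leq_maxl.
rewrite (shift b) -?eq_t //; last by move=> k; rewrite mlcmE leq_maxr.
rewrite -mulrBl -mulrBr; apply: span_mul ab => v lt_vl.
have -> : (mmul t (iter i sm (lm a).1), (i + (lm a).2 + j)%N) =
    (u, i) ** (l, (lm a).2) ** (mone, j).
  by rewrite !smulE /= iter_sigm1 // mulm1 eq_u.
exact: (lt_smul le_mo).
Qed.

(** * Homogeneous generators, and sufficiency of the criterion *)

Hypothesis G_homog : forall g, G g -> exists i a, g = a *: X i.

Lemma SG_homog g : SG g -> exists i a, g = a *: X i.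
Proof.
case=> _ [i [j [/G_homog[k [a ->]] ->]]]; exists (i + k + j)%N, (iter i sigma a).
by rewrite !XD (ts_mulX_scaler ts) -scalerAl.
Qed.

(** It suffices that the unrestricted span is a two-sided ideal. Homogeneity is what makes it stable
    under multiplication on the right. *)
Lemma ideal_gen_span h : ideal_gen G h -> span (fun=> True) h.
Proof.
apply; last first.
  move=> g Gg; have [->|g0] := eqVneq g 0; first exact: span0.
  rewrite -[g]mul1r -(ts_sterm1 ts); apply: span1 => //.
  by exists g, 0%N, 0%N; rewrite X0 mul1r mulr1.
split=> [|f g|a f fT|a f fT]; [exact: span0|exact: spanD| |].
  elim/(ts_ind ts): a => [|a b af bf|c v]; first by rewrite mul0r; apply: span0.
    by rewrite mulrDl; apply: spanD.
  by rewrite -[_ * f]mulr1 -X0; apply: span_mul fT.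
elim/(ts_ind ts): a => [|a b fa fb|d [n j]]; first by rewrite mulr0; apply: span0.
  by rewrite mulrDr; apply: spanD.
elim: fT => [|c t g e Gg g0 _ _ IHe]; first by rewrite mul0r; apply: span0.
rewrite mulrDl; apply: spanD => //; have [k [a def_g]] := SG_homog Gg.
(* For [g = a s^k], commutativity of [P] gives [g d n = a d sigma^k(n) s^k = d sigma^k(n) g]. *)
have -> : sterm c (t, 0%N) * g * sterm d (n, j) =
    sterm c (t, 0%N) * sterm d (iter k sm n, 0%N) * (X 0 * g * X j).
  have -> : sterm d (n, j) = term d n *: X j.
    by rewrite (ts_scaler_sterm ts) (ts_stermM ts) smulE /= mulm1 mulr1.
  rewrite -!mulrA; congr (_ * _); rewrite -(ts_scaler_sterm ts) X0 mul1r def_g.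
  rewrite -!scalerAl (ts_mulX_scaler ts) iter_sigma_term // !scalerA.
  by rewrite mulrC.
have [g'0 _ _] := ts_lm_mulX ts 0 j g0.
by rewrite (ts_stermM ts) smulE; apply: span1 => //; apply: SG_mulX.
Qed.

Hypothesis criterion : forall f g, G f -> f != 0 -> G g -> g != 0 ->
  forall i j : nat,
  ((lm f).2 = ((lm g).2 + i + j)%N -> has_repr (spol f (X i * g * X j))) /\
  (((lm f).2 + i)%N = ((lm g).2 + j)%N -> has_repr (spol (f * X i) (X j * g))).

(** By symmetry [a = s^i f s^j] and [b = s^i' g s^j'] with [i <= i']. Taking out the smaller power
    of [s] on each side leaves [f] and [s^(i'-i) g s^(j'-j)] if [j <= j'], and [f s^(j-j')] and
    [s^(i'-i) g] otherwise: the two families of the criterion. *)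
Lemma SG_spair a b : SG a -> a != 0 -> SG b -> b != 0 ->
  (lm a).2 = (lm b).2 -> spair a b.
Proof.
have deg i j f : f != 0 -> (lm (X i * f * X j)).2 = (i + (lm f).2 + j)%N.
  by move=> f0; have [_ -> _] := ts_lm_mulX ts i j f0.
have neq0 i j f : f != 0 -> X i * f * X j != 0.
  by move=> f0; have [] := ts_lm_mulX ts i j f0.
wlog: a b / exists f g i j i' j', [/\ (i <= i')%N, G f, G g, a = X i * f * X j
    & b = X i' * g * X j'].
  move=> wl [f [i [j [Gf ->]]]] a0 [g [i' [j' [Gg ->]]]] b0 eq_deg.
  have [le_i|/ltnW le_i] := leqP i i'.
    apply: wl => //; first by exists f, g, i, j, i', j'.
      by exists f, i, j.
    by exists g, i', j'.
  apply: spair_sym; apply: wl => //; first by exists g, f, i', j', i, j.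
    by exists g, i', j'.
  by exists f, i, j.
case=> f [g [i [j [i' [j' [le_i Gf Gg -> ->]]]]]] _ a0 _ b0.
have f0 : f != 0 by apply: contraNneq a0 => ->; rewrite mulr0 mul0r.
have g0 : g != 0 by apply: contraNneq b0 => ->; rewrite mulr0 mul0r.
rewrite !deg //; have [le_j|/ltnW le_j] := leqP j j' => eq_deg.
  have -> : X i' * g * X j' = X i * (X (i' - i) * g * X (j' - j)) * X j.
    by rewrite -{1}(subnKC le_i) -{1}(subnK le_j) !XD !mulrA.
  apply: spol_spair => //; first exact: neq0.
    by rewrite deg //; lia.
  by have [+ _] := criterion Gf f0 Gg g0 (i' - i)%N (j' - j)%N; apply; lia.
have -> : X i * f * X j = X i * (f * X (j - j')) * X j'.
  by rewrite -{1}(subnK le_j) !XD !mulrA.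
have -> : X i' * g * X j' = X i * (X (i' - i) * g) * X j'.
  by rewrite -{1}(subnKC le_i) !XD !mulrA.
have := neq0 0%N (j - j')%N f f0; have := deg 0%N (j - j')%N f f0.
have := neq0 (i' - i)%N 0%N g g0; have := deg (i' - i)%N 0%N g g0.
rewrite X0 mul1r mulr1 => deg_g g'0 deg_f f'0; apply: spol_spair => //.
  by rewrite deg_g deg_f; lia.
by have [_] := criterion Gf f0 Gg g0 (j - j')%N (i' - i)%N; apply; lia.
Qed.

(** Any two summands reaching [T] form an S-pair, so one can be traded for a multiple of the other
    plus summands below [T]; at most one summand at [T] remains. *)
Lemma span_le_cancel T h : span_le T h ->
  span_lt T h \/ exists t g c, [/\ SG g, g != 0, (t, 0%N) ** lm g = T
    & span_lt T (h - sterm c (t, 0%N) * g)].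
Proof.
elim=> [|c t g f Gg g0 le_gT _ IHf]; first by left; apply: span0.
have [eq_gT|ne_gT] := eqVneq ((t, 0%N) ** lm g) T; last first.
  have lt_gT : lt ((t, 0%N) ** lm g) T by apply/andP.
  case: IHf => [lt_f|[t' [g' [c' [Gg' g'0 eq_T lt_f]]]]].
    by left; apply: span_cons.
  by right; exists t', g', c'; split=> //; rewrite -addrA; apply: span_cons.
right; case: IHf => [lt_f|[t' [g' [c' [Gg' g'0 eq_T lt_f]]]]].
  by exists t, g, c; split=> //; rewrite addrC addKr.
(* Subtracting [c * lc g] times the S-pair of [g] and [g'] turns [c t g] into
   [(c * lc g / lc g') t' g']. *)
exists t', g', (c' + c * lc g / lc g'); split=> //.
have eq_deg : (lm g).2 = (lm g').2.
  by move: eq_gT; rewrite -eq_T !smulE => -[_ /=]; rewrite !add0n.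
have := SG_spair Gg g0 Gg' g'0 eq_deg; rewrite /spair.
move=> /(_ t t'); rewrite eq_gT eq_T => /(_ erefl) lt_gg'.
have -> : sterm c (t, 0%N) * g + f - sterm (c' + c * lc g / lc g') (t', 0%N) * g' =
    sterm (c * lc g) (mone, 0%N) *
        (sterm (lc g)^-1 (t, 0%N) * g - sterm (lc g')^-1 (t', 0%N) * g')
      + (f - sterm c' (t', 0%N) * g').
  rewrite mulrBr !mulrA !(ts_stermM ts) !smul1 mulfK ?(ts_scf_lm ts) //.
  by rewrite stermD mulrDl opprD [- _ - _]addrC addrACA.
by apply: spanD lt_f; apply: spanZ.
Qed.

(** The bound is the largest leading monomial among the finitely many summands. It satisfies [Q]
    itself, so for [span_lt T] it lies strictly below [T]. *)
Lemma span_max (Q : smon -> Prop) h :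
  span Q h -> h = 0 \/ exists2 T, Q T & span_le T h.
Proof.
elim=> [|c t g f Gg g0 Qg _ IHf]; first by left.
right; set v := (t, 0%N) ** lm g.
have [->|[T' QT' le_f]] := IHf; first exists v => //.
  by apply: span_cons; rewrite ?(le_refl le_mo) //; apply: span0.
have /orP[le_T'|le_T'] := mo_total le_mo v T'.
  by exists T' => //; apply: span_cons.
exists v => //; apply: span_cons; rewrite ?(le_refl le_mo) //.
by apply: span_mono le_f => w le_w; apply: (le_trans le_mo) le_T'.
Qed.

(** Well-founded induction on the bound [T]. Either all summands can be taken below [T], and the
    bound drops, or a single nonzero summand at [T] survives and gives the leading monomial. *)
Lemma span_le_lm T h : span_le T h -> h != 0 ->
  exists t g, [/\ SG g, g != 0 & lm h = (t, 0%N) ** lm g].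
Proof.
elim/(well_founded_ind (mo_wf le_mo)): T h => T IHT h le_hT h0.
have lower : span_lt T h -> exists t g, [/\ SG g, g != 0 & lm h = (t, 0%N) ** lm g].
  by case/span_max=> [/eqP|[T' lt_T' /(IHT _ lt_T')]]; [rewrite (negPf h0) | apply].
case: (span_le_cancel le_hT) => // -[t [g [c [Gg g0 eq_T lt_T]]]].
have [c0|c0] := eqVneq c 0.
  by apply: lower; move: lt_T; rewrite c0 sterm0 mul0r subr0.
have h_sum : h = (h - sterm c (t, 0%N) * g) + sterm c (t, 0%N) * g by rewrite subrK.
(* No monomial of either part exceeds [T], and the coefficient of [h] at [T] is [c * lc g], which is
   nonzero. *)
exists t, g; split=> //; rewrite eq_T; apply: (le_anti le_mo).
  have := ts_scf_lm ts h0; rewrite {1}h_sum (ts_scfD ts).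
  set v := lm h; set r := h - _ in lt_T *.
  have [->|rv _] := eqVneq (scf r v) 0; last by apply/ltW/(scf_span_lt lt_T).
  rewrite add0r => /scf_mull_ex[w gw ->]; rewrite -eq_T.
  by apply/(le_smull sigma_mono le_mo)/(ts_le_lm ts).
apply: (ts_le_lm ts); rewrite h_sum (ts_scfD ts) -{2}eq_T scf_mull.
have [->|/(scf_span_lt lt_T)] := eqVneq (scf (h - sterm c (t, 0%N) * g) T) 0.
  by rewrite add0r mulf_neq0 ?(ts_scf_lm ts).
by rewrite lt_irr.
Qed.

Lemma lm_ideal_gen h : ideal_gen G h -> h != 0 ->
  exists t g, [/\ SG g, g != 0 & lm h = (t, 0%N) ** lm g].
Proof.
move/ideal_gen_span/span_max => [->|[T _ le_hT]]; first by rewrite eqxx.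
exact: span_le_lm le_hT.
Qed.

(** * Monomial ideals and division by [Sigma G Sigma] *)

Definition lmset (A : S -> Prop) (x : S) :=
  exists f, [/\ A f, f != 0 & x = sterm 1 (lm f)].

(** The elements all of whose monomials are two-sided multiples of leading monomials of [A] form an
    ideal containing the generators. *)
Lemma ideal_gen_lmset A v : ideal_gen (lmset A) (sterm 1 v) ->
  exists f p q, [/\ A f, f != 0 & v = p ** lm f ** q].
Proof.
pose D x := forall w, scf x w != 0 ->
  exists f p q, [/\ A f, f != 0 & w = p ** lm f ** q].
have D_ideal : two_sided_ideal D.
  split=> [w|x y Dx Dy w|a x Dx|a x Dx]; first by rewrite (ts_scf0 ts) eqxx.
  - rewrite (ts_scfD ts); have [->|xw _] := eqVneq (scf x w) 0; last exact: Dx.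
    by rewrite add0r; apply: Dy.
  - elim/(ts_ind ts): a => [|a b Da Db|c r] w.
    + by rewrite mul0r (ts_scf0 ts) eqxx.
    + rewrite mulrDl (ts_scfD ts); have [->|aw _] := eqVneq (scf (a * x) w) 0.
        by rewrite add0r; apply: Db.
      exact: Da.
    case/scf_mull_ex=> u /Dx[f [p [q [Af f0 ->]]]] ->.
    by exists f, (r ** p), q; rewrite !smulA.
  - elim/(ts_ind ts): a => [|a b Da Db|c r] w.
    + by rewrite mulr0 (ts_scf0 ts) eqxx.
    + rewrite mulrDr (ts_scfD ts); have [->|aw _] := eqVneq (scf (x * a) w) 0.
        by rewrite add0r; apply: Db.
      exact: Da.
    rewrite -[x]mul1r -X0 => /(ts_scf_mul_ex ts)[u /Dx[f [p [q [Af f0 ->]]]] ->].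
    by exists f, p, (q ** r); rewrite smul1 !smulA.
move=> /(_ D D_ideal) gen_v; apply: (gen_v _ v) => [x [f [Af f0 ->]] w|]; last first.
  by rewrite (ts_scf_sterm ts) eqxx oner_neq0.
rewrite (ts_scf_sterm ts); have [<- _|_] := eqVneq (lm f) w; last by rewrite eqxx.
by exists f, (mone, 0%N), (mone, 0%N); rewrite smul1 smuls1.
Qed.

(* For q = n s^j, v ** q is v ** s^j up to a monomial of P on the left. *)
Lemma smul_lm_SG g p q : G g -> g != 0 ->
  exists t h, [/\ SG h, h != 0 & p ** lm g ** q = (t, 0%N) ** lm h].
Proof.
move=> Gg g0; have [h0 lm_h _] := ts_lm_mulX ts p.2 q.2 g0.
exists (mmul p.1 (iter (p.2 + (lm g).2) sm q.1)), (X p.2 * g * X q.2).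
split=> //; first by exists g, p.2, q.2.
by rewrite lm_h !smulE /= add0n -!mulmA; congr (mmul _ _, _); rewrite mulmC.
Qed.

(** Division: subtracting the multiple of [g] with the same leading term leaves a remainder in [J]
    that is zero or has a smaller leading monomial, and the ordering is well-founded. *)
Lemma repr_ideal (J : S -> Prop) : two_sided_ideal J -> (forall g, G g -> J g) ->
    (forall h, J h -> h != 0 ->
      exists t g, [/\ SG g, g != 0 & lm h = (t, 0%N) ** lm g]) ->
  forall h, J h -> has_repr h.
Proof.
move=> J_ideal GJ J_div h; move def_T: (lm h) => T.
elim/(well_founded_ind (mo_wf le_mo)): T h def_T => T IHT h def_T Jh.
have [->|h0] := eqVneq h 0; first by exists [::]; rewrite big_nil.
have [t [g [Gg g0 lm_hg]]] := J_div h Jh h0.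
have [lc_h lc_g] := (ts_scf_lm ts h0, ts_scf_lm ts g0).
pose c := lc h / lc g; have c0 : c != 0 by rewrite mulf_neq0 ?invr_eq0.
pose h' := h - term c t *: g.
have Jh' : J h'.
  have Jg : J g.
    case: Gg => f [i [j [/GJ Jf ->]]].
    exact: (Defs.idealMr J_ideal _ (Defs.idealMl J_ideal _ Jf)).
  rewrite /h' (ts_scaler_sterm ts) -mulNr.
  by apply: (Defs.idealD J_ideal) => //; apply: (Defs.idealMl J_ideal).
have lm_h' : h' != 0 -> lt (lm h') (lm h).
  move=> h'0; have := ts_scf_lm ts h'0; rewrite {1}/h' (ts_scaler_sterm ts).
  rewrite (ts_scfD ts) scfN => h'_lm; apply/andP; split.
    apply: contraNneq h'_lm => ->; rewrite {2}lm_hg scf_mull /c.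
    by rewrite divfK // subrr.
  have [h'h|] := eqVneq (scf h (lm h')) 0; last exact: (ts_le_lm ts).
  move: h'_lm; rewrite h'h add0r oppr_eq0 => /scf_mull_ex[w gw ->].
  by rewrite lm_hg; apply/(le_smull sigma_mono le_mo)/(ts_le_lm ts).
have le_lm_term : le (lm (term c t)%:A ** lm g) (lm h).
  rewrite (ts_scaler_sterm ts) mulr1 lm_hg.
  have ct0 : sterm c (t, 0%N) != 0.
    by apply: contraNneq c0 => e; have := ts_scf_sterm ts c (t, 0%N) (t, 0%N);
      rewrite e (ts_scf0 ts) eqxx => /esym/eqP.
  have := ts_scf_lm ts ct0; rewrite (ts_scf_sterm ts).
  have [<- _|_] := eqVneq (t, 0%N) _; last by rewrite eqxx.
  exact: (le_refl le_mo).
have term0 : term c t != 0.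
  by apply: contraNneq c0 => e; have := coef_term c t t;
    rewrite e mcoeff0 eqxx => /esym/eqP.
have h_sum : h = term c t *: g + h' by rewrite addrC subrK.
(* A zero remainder is treated apart, since its [lm] is junk and cannot feed the induction. *)
have [h'0|h'0] := eqVneq h' 0.
  exists [:: (term c t, g)]; rewrite big_seq1 /= {1}h_sum h'0 addr0; split=> //.
  by move=> p; rewrite inE => /eqP->; split.
have [|r [h'_sum r_small]] := IHT (lm h') _ h' erefl Jh'; first by rewrite -def_T lm_h'.
exists ((term c t, g) :: r); rewrite big_cons -h'_sum; split=> // p.
rewrite inE => /predU1P[->|/r_small[p0 Gp p'0 le_p]]; first by split.
by split=> //; apply: (le_trans le_mo) le_p _; apply: ltW; apply: lm_h'.
Qed.

End SigmaCriterion.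

(** * Transfer of the abstract argument to [skewpoly] *)

Section Skew.
Context {K : fieldType}.
Local Notation P := (polyring K).
Variable sigma : {rmorphism P -> P}.
Local Notation S := (skewpoly sigma).
Local Notation sterm := (sterm sigma).
Hypothesis sigma_mono : monomial_preserving sigma.
Hypothesis sigma_scalable : scalable sigma.
Variable le : rel smon.
Hypothesis le_mo : monomial_ordering sigma le.

Lemma skew_term_structure : term_structure sigma le sterm scf (lm le).
Proof.
split.
- exact: scfD.
- exact: scf0.
- exact: scfP.
- exact: scf_sterm.
- exact: stermM.
- by rewrite stermX expr0.
- exact: scaler_sterm.
- exact: mulX_scaler.
- exact: scf_scalar.
- exact: sterm_ind.
- exact: (scf_lm le_mo).
- exact: (le_lm le_mo).
- exact: (scf_smul sigma_mono sigma_scalable le_mo).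
- exact: (scf_smul_ex sigma_mono sigma_scalable).
- exact: (lm_mulX sigma_mono sigma_scalable le_mo).
Qed.

Variable G : S -> Prop.

Lemma Sigma_closureE h : Sigma_closure G h <-> SG sterm G h.
Proof.
by split=> -[g [i [j [Gg ->]]]]; exists g, i, j; (split; first exact: Gg);
  rewrite !stermX.
Qed.

Lemma groebner_reprE h : groebner_repr le (Sigma_closure G) h
  <-> has_repr sigma le sterm (lm le) G h.
Proof.
split=> -[r [h_sum r_small]]; exists r; (split; first exact: h_sum) => p.
  case/r_small=> p0 /Sigma_closureE Gp p'0; rewrite smon_mulE => le_ph.
  by split; [exact: p0|exact: Gp|exact: p'0|exact: le_ph].
case/r_small=> p0 /(proj2 (Sigma_closureE _)) Gp p'0 le_ph; rewrite smon_mulE.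
by split; [exact: p0|exact: Gp|exact: p'0|exact: le_ph].
Qed.

Lemma spolyE f g : spoly le f g = spol (@scf K sigma) (lm le) f g.
Proof. by rewrite /spoly /spol !termE !lcE. Qed.

Lemma lm_setE (A : S -> Prop) x : lm_set le A x <-> lmset sterm (lm le) A x.
Proof.
by split=> -[f [Af f0 ->]]; exists f; split=> //; rewrite smon_eltE.
Qed.

(** All monomials of a homogeneous element share one [s]-exponent. This turns the degree conditions
    of the criterion into conditions on leading monomials. *)
Lemma sdeg_homog (f : S) : shomogeneous f -> f != 0 -> sdeg f = (lm le f).2.
Proof.
case=> i [a def_f] f0.
have f_i j : scoef f j = a * (j == i)%:R by rewrite def_f scoefZ scoefXn.
have a0 : a != 0 by apply: contraNneq f0 => a0; rewrite def_f a0 scale0r.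
have -> : (lm le f).2 = i.
  have := scf_lm le_mo f0; case: (lm le f) => m j /=; rewrite -scfE f_i.
  by have [//|_] := eqVneq j i; rewrite mulr0 mcoeff0 eqxx.
have def_c : skewcoefs f = a%:P * 'X^i.
  by apply/polyP => j; rewrite coefCM coefXn; apply: f_i.
rewrite /sdeg def_c.
by rewrite size_Mmonic ?polyC_eq0 ?monicXn // size_polyXn size_polyC a0 addnC addn1.
Qed.

End Skew.

Theorem proposition4p5 (K : fieldType)
    (sigma : {lrmorphism polyring K -> polyring K})
    (sigma_inj : injective sigma)
    (sigma_order : infinite_order sigma)
    (sigma_mono : monomial_preserving sigma)
    (sigma_coprime : coprime_on_vars sigma)
    (le : rel smon) (le_mo : monomial_ordering sigma le)
    (J : skewpoly sigma -> Prop) (J_ideal : two_sided_ideal J)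
    (J_graded : graded J)
    (G : skewpoly sigma -> Prop) (G_basis : is_basis G J)
    (G_homog : forall g, G g -> shomogeneous g) :
  groebner_basis le G J <->
  forall f g, G f -> f != 0 -> G g -> g != 0 -> forall i j : nat,
    (sdeg f = (sdeg g + i + j)%N ->
       groebner_repr le (Sigma_closure G)
         (spoly le f (skewX sigma ^+ i * g * skewX sigma ^+ j))) /\
    ((sdeg f + i)%N = (sdeg g + j)%N ->
       groebner_repr le (Sigma_closure G)
         (spoly le (f * skewX sigma ^+ i) (skewX sigma ^+ j * g))).
Proof.
have sigma_scalable : scalable sigma by move=> c p; apply: linearZ.
have ts := skew_term_structure sigma_mono sigma_scalable le_mo.
have GJ g : G g -> J g by move=> Gg; apply/G_basis => I _; apply.
have sdegE g : G g -> g != 0 -> sdeg g = (lm le g).2.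
  by move=> Gg; apply: sdeg_homog (G_homog g Gg).
split=> [[_ lmGJ] f g Gf f0 Gg g0 i j|criterion].
  (* The S-polynomials lie in [J], so it is enough to represent every element of [J] by division. *)
  have J_repr h : J h -> groebner_repr le (Sigma_closure G) h.
    move=> Jh; apply/groebner_reprE.
    apply: (repr_ideal sigma_mono le_mo ts J_ideal GJ) Jh => {}h Jh h0.
    have /lmGJ : ideal_gen (lm_set le J) (smon_elt (lm le h)).
      by move=> I _; apply; exists h.
    have lmsetG x : lm_set le G x <-> lmset (sterm sigma) (lm le) G x.
      exact: lm_setE.
    move=> gen_h; have {gen_h} : ideal_gen (lmset (sterm sigma) (lm le) G)
        (sterm sigma 1 (lm le h)).
      by rewrite -smon_eltE => I I_ideal lmI; apply: gen_h => // x /lmsetG/lmI.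
    case/(ideal_gen_lmset sigma_mono ts)=> e [p [q [Ge e0 ->]]].
    exact: (smul_lm_SG ts p q Ge e0).
  have JX k l x : J x -> J (skewX sigma ^+ k * x * skewX sigma ^+ l).
    by move=> Jx; apply: (Defs.idealMr J_ideal _ (Defs.idealMl J_ideal _ Jx)).
  have JZ (a : polyring K) x : J x -> J (a *: x).
    by move=> Jx; rewrite -[x]mul1r skew_scaleAl; apply: (Defs.idealMl J_ideal).
  have J_spoly a b : J a -> J b -> J (spoly le a b).
    move=> Ja Jb; apply: (Defs.idealD J_ideal); first exact: JZ.
    by rewrite -scaleNr; apply: JZ.
  split=> _; apply: J_repr; apply: J_spoly.
  - exact: GJ.
  - exact/JX/GJ.
  - exact: (Defs.idealMr J_ideal _ (GJ f Gf)).
  - exact: (Defs.idealMl J_ideal _ (GJ g Gg)).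
split=> [//|x]; split=> gen_x I I_ideal lmI; apply: gen_x => // y.
  by case=> g [Gg g0 ->]; apply: lmI; exists g; split=> //; apply: GJ.
case=> h [/G_basis gen_h h0 ->].
have [||t [_ [[g [i [j [Gg ->]]]] g0 lm_h]]] :=
  lm_ideal_gen sigma_mono sigma_scalable sigma_coprime le_mo ts _ _ gen_h h0.
- move=> g /G_homog[i [a ->]]; exists i, a; by rewrite stermX.
- move=> f g Gf f0 Gg g0 i j; have [crit1 crit2] := criterion f g Gf f0 Gg g0 i j.
  rewrite !stermX -!sdegE // -!spolyE; split=> [/crit1|/crit2] /groebner_reprE; exact.
have {}g0 : g != 0 by apply: contraNneq g0 => ->; rewrite mulr0 mul0r.
have [_ lm_g _] := lm_mulX sigma_mono sigma_scalable le_mo i j g0.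
(* Here [lm h = t s^i lm(g) s^j]; splitting the coefficient 1 into products of ones factors the term
   in [S], with [lm(g)] in the middle. *)
rewrite smon_eltE lm_h lm_g -smulX // -[1]mulr1 -stermM // -[1]mulr1 -stermM //.
rewrite -[1]mulr1 -stermM // -(smon_eltE sigma (lm le g)).
apply: (Defs.idealMl I_ideal); apply: (Defs.idealMr I_ideal).
by apply: (Defs.idealMl I_ideal); apply: lmI; exists g.
Qed.
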